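(* Let $p$ be a prime, $n\ge 2$ and $t\ge 1$ integers, and $\mathcal{D}$ the Desarguesian $(t-1)$-spread of $\mathrm{PG}(nt-1,p)$. Let $\Sigma$ be a $\mathcal{D}_{n-2}$-subspace (an $(nt-t-1)$-dimensional subspace spanned by elements of $\mathcal{D}$), let $\Sigma'$ be an $(nt-t)$-dimensional subspace containing $\Sigma$, let $Y\in\mathcal{D}$ with $Y\subseteq\Sigma$, let $\Omega$ be a hyperplane of $Y$, let $\Gamma'$ be an $(nt-2t+1)$-dimensional subspace of $\Sigma'$ disjoint from $\Omega$, let $\Gamma=\Gamma'\cap\Sigma$ and let $T$ be the point $\Gamma\cap Y$. Let $\bar{B}$ be a blocking set with respect to the hyperplanes of $\Gamma'$ such that $\bar{B}\cap\Gamma$ is a single point and such that for every line $\ell$ of $\Gamma'$ through $T$ we have $\ell\setminus\{T\}\not\subseteq\bar{B}$, and let $K$ be the cone with vertex $\Omega$ and base $\bar{B}$. If $B=\mathcal{B}(K)$ is a small minimal blocking set with respect to the hyperplanes of $\mathrm{PG}(n-1,p^t)$, then $B$ is $\mathbb{F}_p$-linear and of R\'edei-type.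
   Context: Field reduction: each point of $\mathrm{PG}(n-1,p^t)$ corresponds to a $(t-1)$-dimensional subspace of $\mathrm{PG}(nt-1,p)$ (the $1$-dimensional $\mathbb{F}_{p^t}$-subspace viewed over $\mathbb{F}_p$); these form the Desarguesian $(t-1)$-spread $\mathcal{D}$, and a $\mathcal{D}_{r-1}$-subspace is an $(rt-1)$-dimensional subspace spanned by elements of $\mathcal{D}$. For $U\subseteq\mathrm{PG}(nt-1,p)$, $\mathcal{B}(U)$ is the set of elements of $\mathcal{D}$ meeting $U$, identified with points of $\mathrm{PG}(n-1,p^t)$. The cone with vertex $\Omega$ and base $\bar B$ is $\bigcup_{P\in\bar B}\langle P,\Omega\rangle$. A blocking set (with respect to hyperplanes) meets every hyperplane; minimal means no proper subset does; small means fewer than $3(p^t+1)/2$ points. $B$ is $\mathbb{F}_p$-linear if $B=\mathcal{B}(\mu)$ for some subspace $\mu$ of $\mathrm{PG}(nt-1,p)$. $B$ is of R\'edei-type if some hyperplane meets $B$ in exactly $|B|-p^t$ points. *)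

(* Defs.v *)
(* Field reduction modelled concretely:
   F_{p^t} = a finite field L with #|L| = p^t, V = 'rV[L]_n = F_{p^t}^n.
   Viewed over F_p (L has characteristic p), V is F_p^{nt}; projective
   subspaces of PG(nt-1,p) are F_p-subspaces of V, i.e. (since char = p)
   additive subgroups, represented as {set V}.  A projective subspace of
   projective dimension d is a subspace S with #|S| = p^(d+1)
   ("vector dimension" d+1).  Points of PG(n-1,p^t) are the 1-dimensional
   L-subspaces {c v | c in L} (v <> 0), which are exactly the elements of
   the Desarguesian spread D. *)
From HB Require Import structures.
From mathcomp Require Import all_boot all_order all_algebra.
Set Implicit Arguments.
Unset Strict Implicit.
Unset Printing Implicit Defensive.
Import GRing.Theory.
Local Open Scope ring_scope.

Section FieldReduction.
Variables (L : finFieldType) (n : nat).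
Local Notation V := 'rV[L]_n.

(* F_p-subspace of V (= projective subspace of PG(nt-1,p)) *)
Definition is_sub (S : {set V}) : bool :=
  (0 \in S) && [forall x in S, [forall y in S, x + y \in S]].

(* S is a subspace of vector dimension k over F_p
   (projective dimension k-1) *)
Definition vdim_is (p : nat) (S : {set V}) (k : nat) : bool :=
  is_sub S && (#|S| == (p ^ k)%N).

Definition span (X : {set V}) : {set V} :=
  \bigcap_(S : {set V} | is_sub S && (X \subset S)) S.

Definition Lline (v : V) : {set V} := [set c *: v | c : L].

Definition spread : {set {set V}} :=
  [set X : {set V} | [exists v : V, (v != 0) && (X == Lline v)]].

(* D_{r-1}-subspace: (rt-1)-dim. subspace spanned by elements of D *)
Definition Dsubspace (p t : nat) (S : {set V}) (r : nat) : bool :=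
  vdim_is p S (r * t) &&
  (S == span (\bigcup_(X in spread | X \subset S) X)).

Definition meets (X U : {set V}) : bool := ~~ (X :&: U \subset [set 0]).

Definition Bof (U : {set V}) : {set {set V}} := [set X in spread | meets X U].

Definition cone (Omega : {set V}) (Bbar : {set {set V}}) : {set V} :=
  \bigcup_(P in Bbar) span (P :|: Omega).

Definition L_hyperplane (H : {set V}) : bool :=
  [&& is_sub H, [forall c : L, [forall x in H, c *: x \in H]]
    & #|H| == (#|L| ^ n.-1)%N].

Definition blocking (B : {set {set V}}) : Prop :=
  B \subset spread /\
  forall H : {set V}, L_hyperplane H -> exists2 X, X \in B & X \subset H.

Definition minimal_blocking (B : {set {set V}}) : Prop :=
  blocking B /\ forall B' : {set {set V}}, B' \proper B -> ~ blocking B'.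

Definition small (p t : nat) (B : {set {set V}}) : Prop :=
  (2 * #|B| < 3 * (p ^ t + 1))%N.

Definition Fp_linear (B : {set {set V}}) : Prop :=
  exists mu : {set V}, is_sub mu /\ B = Bof mu.

Definition Redei_type (p t : nat) (B : {set {set V}}) : Prop :=
  exists H : {set V}, L_hyperplane H /\
    (#|[set X in B | X \subset H]| + p ^ t)%N = #|B|.

(* Bbar is a blocking set w.r.t. the hyperplanes of the subspace G,
   where G has vector dimension k (hyperplanes have vector dim k-1) *)
Definition blocking_in (p : nat) (G : {set V}) (k : nat)
    (Bbar : {set {set V}}) : Prop :=
  (forall P, P \in Bbar -> vdim_is p P 1 /\ P \subset G) /\
  forall H : {set V}, vdim_is p H k.-1 -> H \subset G ->
    exists2 P, P \in Bbar & P \subset H.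

End FieldReduction.

(* Main.v *)
(* Let S be the affine part (outside Sigma) of the base, scaled into one coset
   of Sigma, and let d span its unique point in Sigma.  The elements of the
   spread through S + Omega are distinct, so smallness of B gives 2|S| <= 3p.
   Every functional g with g(d) <> 0 vanishes somewhere on S, and Blokhuis'
   lacunary polynomial argument then shows that S contains a full line
   s0 + <d>: for a functional y killing d, the polynomial with roots y(s) is
   X^p g + h with deg g, deg h <= |S| - p < p/2, which forces a root c_y of
   multiplicity at least p; two heavy levels meet a third in S because
   3p > 2|S|, so y |-> c_y is additive, and averaging over y shows that p points
   of S lie on every heavy level, that is, on one translate of <d>.  (For p = 2
   three points are handled directly.)  Hence mu = <s0, d, Omega> lies in the
   cone; it has p^(t+1) elements, so B(mu) meets every hyperplane, and
   minimality gives B = B(mu).  Exactly p^t elements of B(mu) are not in Sigma. *)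
Require Import Defs.
From mathcomp Require Import all_boot all_order all_algebra.
From mathcomp Require Import all_fingroup all_solvable finfield mxabelem.
From mathcomp Require Import zify ring.
Set Implicit Arguments.
Unset Strict Implicit.
Unset Printing Implicit Defensive.
Import GRing.Theory.
Local Open Scope ring_scope.

(** * Products of linear factors in two variables *)

(** The product has total degree [size r]. Its top homogeneous part is the product of X - a_i Y, the
    homogenization of the product of X - a_i; the b_i enter only in lower degree. *)
Lemma coef_prod_XsubC_lin (F : comNzRingType) (I : Type) (r : seq I) (a b : I -> F) j e :
  (size r <= j + e)%N ->
  (\prod_(i <- r) ('X - ((a i)%:P * 'X + (b i)%:P)%:P))`_j`_e =
  (\prod_(i <- r) ('X - (a i)%:P))`_j *+ (j + e == size r)%N.
Proof.
elim: r j e => [|i r IHr] j e.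
  by rewrite !big_nil !coef1 => _; case: j e => [|j] [|e]; rewrite ?coef0 ?coef1.
rewrite !big_cons /= => le_rj.
rewrite !mulrBl !coefB !coefXM !coefCM mulrDl coefD -mulrA !coefCM coefXM.
have -> : (\prod_(j <- r) ('X - ((a j)%:P * 'X + (b j)%:P)%:P))`_j`_e = 0.
  by rewrite IHr 1?ltnW // gtn_eqF.
rewrite mulr0 addr0 mulrnBl; congr (_ - _).
  case: j le_rj => [|j] le_rj /=; first by rewrite mul0rn coef0.
  by rewrite IHr.
case: e le_rj => [|e] le_rj /=.
  rewrite mulr0 addn0; case: eqP => [->|_]; rewrite ?mulr0n // mulr1n nth_default ?mulr0 //.
  by rewrite size_prod_XsubC.
by rewrite addnS in le_rj *; rewrite IHr // mulrnAr eqSS.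
Qed.

Lemma horner_coef_prod_XsubC_lin (F : comNzRingType) (I : Type) (r : seq I) (a b : I -> F) j y :
  ((\prod_(i <- r) ('X - ((a i)%:P * 'X + (b i)%:P)%:P))`_j).[y] =
  (\prod_(i <- r) ('X - (a i * y + b i)%:P))`_j.
Proof.
rewrite -[LHS]/(horner_eval y _) -coef_map rmorph_prod; congr (polyseq _)`_j.
apply: eq_bigr => i _; rewrite rmorphB /= map_polyX map_polyC /= /horner_eval.
by rewrite !hornerE.
Qed.

(** * Lacunary polynomials over F_p and blocking in the affine plane *)

Section PlanarBlocking.
Variable p : nat.
Hypothesis p_pr : prime p.
Local Notation F := 'F_p.

Lemma Fp_exprp (x : F) : x ^+ p = x.
Proof. by rewrite -{2}(expf_card x) card_Fp. Qed.

Lemma Fp_genPoly : 'X^p - 'X = \prod_(x : F) ('X - x%:P).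
Proof. by rewrite -finField_genPoly card_Fp. Qed.

Lemma Fp_poly_eq0 (q : {poly F}) : (size q <= p)%N -> (forall x, q.[x] = 0) -> q = 0.
Proof.
move=> sz_q q0; apply: (@roots_geq_poly_eq0 _ q (enum F)); last 1 first.
- by rewrite -cardE card_Fp.
- by apply/allP=> x _; rewrite rootE q0.
- exact: enum_uniq.
Qed.

Lemma Fp_genPoly_dvd (q : {poly F}) : (forall x, q.[x] = 0) -> 'X^p - 'X %| q.
Proof.
move=> q0; rewrite Fp_genPoly -big_enum /=; apply: uniq_roots_dvdp.
  by apply/allP=> x _; rewrite rootE q0.
by rewrite uniq_rootsE enum_uniq.
Qed.

Lemma size_XpsubX : size ('X^p - 'X : {poly F}) = p.+1.
Proof. by rewrite size_polyDl size_polyXn // size_polyN size_polyX ltnS prime_gt1. Qed.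

(** For fixed y, the product of X - (a_i y + b_i) vanishes on all of F_p, so X^p - X divides it, and
    this fixes its coefficients of X^j for s < j < p, independently of y. As polynomials in y these
    have degree at most [size r - j] < p, so they are constant; their top coefficients are the
    coefficients of the product of X - a_i. *)
Lemma blocking_coef0 (I : eqType) (r : seq I) (a b : I -> F) :
  (forall x y : F, exists2 i, i \in r & x = a i * y + b i) ->
  (p <= size r)%N /\ forall j, (size r - p < j < p)%N ->
    (\prod_(i <- r) ('X - (a i)%:P))`_j = 0.
Proof.
move=> blk; pose Ry (y : F) := \prod_(i <- r) ('X - (a i * y + b i)%:P).
have RyE (y : F) : Ry y = \prod_(c <- [seq a i * y + b i | i <- r]) ('X - c%:P) by rewrite big_map.
have Ry0 (y x : F) : (Ry y).[x] = 0.
  have [i ri ->] := blk x y; apply/eqP; rewrite -/(root _ _) RyE root_prod_XsubC.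
  by apply/mapP; exists i.
have Ry_mon (y : F) : Ry y \is monic by rewrite RyE monic_prod_XsubC.
have sz_Ry (y : F) : size (Ry y) = (size r).+1 by rewrite RyE size_prod_XsubC size_map.
have le_pr : (p <= size r)%N.
  by have:= dvdp_leq (monic_neq0 (Ry_mon 0)) (Fp_genPoly_dvd (Ry0 0)); rewrite size_XpsubX sz_Ry.
split=> // j /andP[lt_sj lt_jp]; set s := (size r - p)%N in lt_sj.
(* In (X^p - X) q only - X q contributes below X^p, and q is monic of degree s. *)
have Ryj (y : F) : (Ry y)`_j = - (j == s.+1)%:R.
  have /dvdpP[q Eq] := Fp_genPoly_dvd (Ry0 y).
  have XX_mon : 'X^p - 'X \is @monic F by rewrite Fp_genPoly monic_prod_XsubC.
  have q_mon : q \is monic by rewrite -(monicMr _ XX_mon) -Eq.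
  have sz_q : size q = s.+1.
    have := sz_Ry y; rewrite Eq size_Mmonic ?monic_neq0 // size_XpsubX /s addnS /=.
    by move: (size q) le_pr => m; lia.
  rewrite Eq mulrBr coefB coefMXn lt_jp sub0r coefMX.
  case: j lt_sj lt_jp => [|j] //= lt_sj _; rewrite eqSS; congr (- _).
  case: eqP => [->|ne]; first by move/monicP: q_mon; rewrite lead_coefE sz_q.
  by rewrite nth_default // sz_q; lia.
pose R : {poly {poly F}} := \prod_(i <- r) ('X - ((a i)%:P * 'X + (b i)%:P)%:P).
have Rj (y : F) : (R`_j).[y] = - (j == s.+1)%:R. by rewrite horner_coef_prod_XsubC_lin Ryj.
have sz_Rj : (size (R`_j)%R <= p)%N.
  apply/leq_sizeP => e le_pe; rewrite coef_prod_XsubC_lin; last by rewrite /s in lt_sj; lia.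
  rewrite gtn_eqF ?mulr0n //; rewrite /s in lt_sj; lia.
have: R`_j + ((j == s.+1)%:R)%:P = 0.
  apply: Fp_poly_eq0 => [|y]; last by rewrite hornerD Rj hornerC addNr.
  by rewrite (leq_trans (size_polyD _ _)) // geq_max sz_Rj (leq_trans (size_polyC_leq1 _)) ?prime_gt0.
(* This exponent of y is positive because j < p <= [size r], so the constant term does not
   interfere. *)
move/(congr1 (fun q : {poly F} => q`_(size r - j))).
rewrite coefD coefC coef0 subn_eq0 leqNgt (leq_trans lt_jp le_pr) /= addr0.
by rewrite coef_prod_XsubC_lin subnKC ?eqxx //; lia.
Qed.

(** A root of multiplicity m is a root of the derivative of multiplicity at least m - 1, and X^p - X
    supplies the missing factor. *)
Lemma split_dvd_genPoly_deriv (r : seq F) :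
  \prod_(c <- r) ('X - c%:P) %| ('X^p - 'X) * (\prod_(c <- r) ('X - c%:P))^`().
Proof.
elim: r => [|c r IHr]; first by rewrite big_nil dvd1p.
rewrite big_cons derivM derivXsubC mul1r mulrDr dvdp_add //.
  rewrite dvdp_mul // -['X - c%:P]expr1 -root_factor_theorem //.
  by rewrite rootE !hornerE Fp_exprp subrr.
by rewrite mulrCA dvdp_mul2l // polyXsubC_eq0.
Qed.

(* x d/dx multiplies the leading term by the degree, so a vanishing Wronskian
   forces equal degrees modulo p. *)
Lemma wronskian0_scale (g h : {poly F}) :
  g \is monic -> (size g <= p)%N -> (size h <= size g)%N ->
  h^`() * g = g^`() * h -> exists c, h = c *: g.
Proof.
move=> g_mon sz_g sz_h W0; pose s := (size g).-1.
have sz_gE : size g = s.+1 by rewrite /s prednK // size_poly_gt0 monic_neq0.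
(* Subtracting this multiple of [g] cancels the coefficient of X^s, so [k] has smaller degree than
   [g], and its Wronskian with [g] is still zero. *)
exists (h`_s); apply/eqP; rewrite -subr_eq0; set k := h - _.
have Wk : k^`() * g = g^`() * k.
  by rewrite /k derivB derivZ mulrBl mulrBr W0 -scalerAl -scalerAr.
have sz_k : (size k <= s)%N.
  apply/leq_sizeP => j le_sj; rewrite coefB coefZ.
  move: le_sj; rewrite leq_eqVlt => /predU1P[<-|lt_sj].
    by have /monicP := g_mon; rewrite lead_coefE sz_gE /= => ->; rewrite mulr1 subrr.
  rewrite [h`_j]nth_default ?[g`_j]nth_default ?mulr0 ?subrr ?sz_gE //.
  by rewrite (leq_trans sz_h) // sz_gE.
apply/negPn/negP => k0; pose d := (size k).-1.
have sz_kE : size k = d.+1 by rewrite /d prednK // size_poly_gt0.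
have lowD (q : {poly F}) m : (size q = m.+1)%N -> (size ('X * q^`() - m%:R *: q)%R <= m)%N.
  move=> sz_q; apply/leq_sizeP => j le_mj; rewrite coefB coefZ coefXM.
  have -> : (if j == 0%N then 0 else q^`()`_j.-1) = q`_j *+ j.
    by case: (j) => [|j'] /=; rewrite ?mulr0n // coef_deriv.
  move: le_mj; rewrite leq_eqVlt => /predU1P[<-|lt_mj]; first by rewrite mulr_natl subrr.
  by rewrite !nth_default ?mulr0 ?mul0rn ?subrr // sz_q.
have E : (s%:R - d%:R) *: (k * g) = ('X * k^`() - d%:R *: k) * g - ('X * g^`() - s%:R *: g) * k.
  rewrite -!mul_polyC polyCB.
  transitivity ('X * (k^`() * g - g^`() * k) + ((s%:R)%:P - (d%:R)%:P) * (k * g)); last by ring.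
  by rewrite Wk subrr mulr0 add0r.
have nz : s%:R - d%:R != 0 :> F.
  rewrite -natrB; last by lia.
  rewrite -(dvdn_pcharf (pchar_Fp p_pr)) gtnNdvd; lia.
have := size_scale (k * g) nz; rewrite E size_Mmonic // sz_kE sz_gE addnS /=.
suff: (size (('X * k^`() - d%:R *: k) * g - ('X * g^`() - s%:R *: g) * k)%R
        <= d + s)%N by move=> + e; rewrite e; lia.
rewrite (leq_trans (size_polyD _ _)) // size_polyN geq_max.
apply/andP; split; rewrite (leq_trans (size_polyMleq _ _)) // ?sz_kE ?sz_gE addnS /=.
  by rewrite leq_add2r lowD.
by rewrite addnC leq_add2l lowD.
Qed.

Lemma count_XsubC_exp_dvd (r : seq F) c m :
  ('X - c%:P) ^+ m %| \prod_(x <- r) ('X - x%:P) -> (m <= count_mem c r)%N.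
Proof.
have nz (s : seq F) : \prod_(x <- s) ('X - x%:P) != 0.
  exact: monic_neq0 (monic_prod_XsubC _ _ _).
rewrite -mup_geq // => le_m; apply: leq_trans le_m _.
elim: r => [|x r IHr]; first by rewrite big_nil mupNroot // root1.
rewrite big_cons mupM ?polyXsubC_eq0 ?nz //= leq_add //.
by rewrite -['X - _]expr1 mup_XsubCX; case: eqP.
Qed.

(** Write f = X^p g + h with g monic of degree s and deg h <= s. Then f divides (X g + h)(h' g - g'
    h), whose degree is at most 3s < p + s, so this product is zero. Its first factor is monic,
    hence the Wronskian vanishes, h = c g, and f = (X^p + c) g = (X + c)^p g. *)
Lemma lacunary_multiple_root (r : seq F) :
  (2 < p)%N -> (2 * size r <= 3 * p)%N -> (p <= size r)%N ->
  (forall j, (size r - p < j < p)%N -> (\prod_(c <- r) ('X - c%:P))`_j = 0) ->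
  exists c, (p <= count_mem c r)%N.
Proof.
move=> p_gt2 ler32 le_pr lac; set f := \prod_(c <- r) _ in lac.
pose s := (size r - p)%N; pose g := drop_poly p f; pose h := take_poly p f.
(* The size bound gives 2s <= p, and equality fails because p is odd. *)
have lt2sp : (2 * s < p)%N.
  have := prime_oddPn p_pr; rewrite /s; have [|] := boolP (odd p); last first.
    by move=> /prime_oddPn-/(_ p_pr) p2; lia.
  lia.
have f_mon : f \is monic by exact: monic_prod_XsubC.
have sz_f : size f = (p + s).+1 by rewrite size_prod_XsubC /s subnKC.
have fE : f = g * 'X^p + h by rewrite addrC poly_take_drop.
have sz_g : size g = s.+1 by rewrite size_drop_poly sz_f; lia.
have g_mon : g \is monic.
  apply/monicP; rewrite lead_coefE sz_g coef_drop_poly /=.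
  by move/monicP: f_mon; rewrite lead_coefE sz_f /= addnC.
have sz_h : (size h <= s.+1)%N.
  apply/leq_sizeP => j lt_sj; rewrite coef_take_poly; case: ifP => // lt_jp.
  by rewrite lac // lt_jp andbT.
have dXp : ('X^p : {poly F})^`() = 0.
  by rewrite derivXn -scaler_nat (pcharf0 (pchar_Fp p_pr)) scale0r.
have dfE : f^`() = g^`() * 'X^p + h^`() by rewrite fE derivD derivM dXp mulr0 addr0.
(* Modulo f, X^p g = - h; the derivative kills X^p. *)
have dvdf : f %| ('X * g + h) * (h^`() * g - g^`() * h).
  have -> : ('X * g + h) * (h^`() * g - g^`() * h) =
      f * (f^`() * g) - f * (g^`() * ('X * g + h)) - ('X^p - 'X) * f^`() * (g * g).
    have alg (x u v w v' w' : {poly F}) : (x * v + w) * (w' * v - v' * w) =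
      (v * u + w) * ((v' * u + w') * v) - (v * u + w) * (v' * (x * v + w))
        - (u - x) * (v' * u + w') * (v * v) by ring.
    by rewrite dfE {1 2}fE; apply: alg.
  rewrite dvdp_sub ?dvdp_sub ?dvdp_mulIl // dvdp_mulr //.
  exact: split_dvd_genPoly_deriv.
have /eqP : ('X * g + h) * (h^`() * g - g^`() * h) == 0.
  apply: contraTT dvdf => /gtNdvdp-> //.
  rewrite sz_f ltnS (leq_trans (size_polyMleq _ _)) //.
  have szA : (size ('X * g + h)%R <= s.+2)%N.
    rewrite (leq_trans (size_polyD _ _)) // geq_max (leq_trans sz_h) // andbT.
    by rewrite (leq_trans (size_polyMleq _ _)) // size_polyX sz_g.
  have szB (u v : {poly F}) : (size u <= s.+1 -> size v <= s.+1 -> size (u^`() * v)%R <= 2 * s)%N.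
    move=> szu szv; have [->|u0] := eqVneq u 0; first by rewrite deriv0 mul0r size_poly0.
    rewrite (leq_trans (size_polyMleq _ _)) //.
    by have := lt_size_deriv u0; lia.
  have szC : (size (h^`() * g - g^`() * h)%R <= 2 * s)%N.
    by rewrite (leq_trans (size_polyD _ _)) // size_polyN geq_max !szB // sz_g.
  apply: leq_trans (_ : ((s.+2 + 2 * s).-1 <= _)%N); last by lia.
  by rewrite -!subn1 leq_sub2r // leq_add.
move/eqP; rewrite mulf_eq0 => /orP[|/eqP/subr0_eq].
  move/eqP/(congr1 (fun q : {poly F} => q`_s.+1)).
  rewrite coefD coefXM /= (nth_default _ sz_h) addr0 coef0.
  by move/monicP: g_mon; rewrite lead_coefE sz_g /= => -> /eqP; rewrite oner_eq0.
case/wronskian0_scale=> // [||c hE]; rewrite ?sz_g //; first by lia.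
exists (- c); apply: count_XsubC_exp_dvd; rewrite -/f fE hE -mul_polyC (mulrC c%:P) -mulrDr.
rewrite dvdp_mull // polyCN opprK.
suff -> : ('X + c%:P) ^+ p = 'X^p + c%:P by [].
have pP : p \in [pchar {poly F}] by rewrite (pchar_poly) pchar_Fp.
by rewrite -!(pFrobenius_autE pP) rmorphD /= !pFrobenius_autE -polyC_exp Fp_exprp.
Qed.

(** The points (a_i, b_i) meet every non-vertical line of the affine plane; the conclusion is a
    vertical line carrying p of them, counted by index. *)
Lemma planar_blocking (I : finType) (S : {set I}) (a b : I -> F) :
  (2 < p)%N -> (2 * #|S| <= 3 * p)%N ->
  (forall x y : F, exists2 i, i \in S & x = a i * y + b i) ->
  exists c, (p <= #|[set i in S | a i == c]|)%N.
Proof.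
move=> p_gt2 leS blk.
have [|le_pr coef0] := @blocking_coef0 _ (enum S) a b.
  by move=> x y; have [i Si ->] := blk x y; exists i; rewrite ?mem_enum.
rewrite -cardE in le_pr coef0.
have [|||c] := @lacunary_multiple_root [seq a i | i <- enum S] p_gt2.
- by rewrite size_map -cardE.
- by rewrite size_map -cardE.
- by rewrite size_map -cardE => j /coef0; rewrite big_map.
rewrite count_map => le_pc; exists c; apply: leq_trans le_pc _.
rewrite -size_filter cardE uniq_leq_size => [//||i]; first exact/filter_uniq/enum_uniq.
by rewrite mem_filter !mem_enum /= => /andP[ai Si]; rewrite inE Si.
Qed.

End PlanarBlocking.

(** * Counting and linear algebra *)

Lemma leq_cards_setI (T : finType) (S A B : {set T}) :
  A \subset S -> B \subset S -> (#|A| + #|B| <= #|S| + #|A :&: B|)%N.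
Proof. by move=> sAS sBS; rewrite -cardsUI leq_add2r subset_leq_card // subUset sAS. Qed.

Lemma card_setId_sum (T : finType) (A : {set T}) (P : pred T) :
  #|[set x in A | P x]| = (\sum_(x in A) P x)%N.
Proof.
rewrite -sum1_card (eq_bigl (fun x => (x \in A) && P x)) => [|x]; last by rewrite inE.
by rewrite big_mkcondr; apply: eq_bigr => x _; case: (P x).
Qed.

(** A row space is its own double annihilator; the columns of [cokermx U] are the functionals to
    test. *)
Lemma sub_row_functional (F : fieldType) (N m : nat) (U : 'M[F]_(m, N)) (v : 'rV[F]_N) :
  (forall y : 'cV_N, U *m y = 0 -> v *m y = 0) -> (v <= U)%MS.
Proof.
move=> h; rewrite submxE; apply/eqP/matrixP => i j.
have := h (col j (cokermx U)); rewrite !colE (mulmxA U) (mulmxA v) mulmx_coker mul0mx => /(_ erefl).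
by rewrite -colE => /matrixP/(_ i 0); rewrite !mxE.
Qed.

Lemma dual_vector (F : fieldType) (N : nat) (d : 'rV[F]_N) : d != 0 -> exists l : 'cV[F]_N, d *m l = 1.
Proof.
case/rV0Pn=> j dj; exists ((d 0 j)^-1 *: delta_mx j 0).
rewrite -scalemxAr -colE; apply/matrixP=> i k; rewrite !ord1 !mxE mulVf //.
Qed.

(** The image is a nontrivial subgroup of F_p, hence all of it, and the kernel has index p. *)
Lemma card_additive_kernel (p : nat) (V : finZmodType) (G : {group V}) (e : V -> 'F_p) :
  prime p -> {in G &, {morph e : x y / x + y}} -> (exists2 x, x \in G & e x != 0) ->
  (#|[set x in G | e x == 0%R]| * p = #|G|)%N.
Proof.
move=> p_pr eD [x0 Gx0 ex0]; pose f : {morphism G >-> 'F_p} := Morphism eD.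
have -> : [set x in G | e x == 0%R] = ('ker f)%g by apply/setP=> x; rewrite !inE.
have imf : #|(f @* G)%g| = p.
  apply/(prime_nt_dvdP p_pr).
    rewrite -trivg_card1; apply/trivgPn; exists (f x0); rewrite ?mem_morphim //.
  by have := cardSg (subsetT (f @* G)%g); rewrite cardsT card_Fp.
have := card_morphim f G; rewrite setIid => iG.
by rewrite -(Lagrange (subsetIl G _ : 'ker f \subset G)%g) -iG; congr (_ * _)%N.
Qed.

(** * Small sets in an affine hyperplane meeting every linear hyperplane that misses a direction *)

Section AffineBlocking.
Variable p : nat.
Hypothesis p_pr : prime p.
Local Notation F := 'F_p.

Lemma char2_cases (c : F) : p = 2%N -> c = 0 \/ c = 1.
Proof.
move=> p2; have /orP : (c == 0) || (c == 1).
  move: c; rewrite p2 => c; by case: c => [[|[|m]]] //= lt_m; rewrite -?val_eqE.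
by case=> /eqP->; [left | right].
Qed.

Section Functionals.
Variables (N : nat) (S : {set 'rV[F]_N}) (psi : 'cV[F]_N) (d : 'rV[F]_N).
Hypothesis le_S : (2 * #|S| <= 3 * p)%N.
Hypothesis S1 : forall s, s \in S -> s *m psi = 1.
Hypothesis d_psi : d *m psi = 0.
Hypothesis d_neq0 : d != 0.
Hypothesis S_blk : forall f : 'cV_N, d *m f != 0 -> exists2 s, s \in S & s *m f = 0.

(** At most three vectors are available. If d is a combination of their differences, then over F_2
    it is itself a difference of two of them. Otherwise some functional is constant on S and nonzero
    at d, which contradicts [S_blk] after a shift by [psi]. *)
Lemma char2_contains_line : p = 2%N -> exists2 s, s \in S & s + d \in S.
Proof.
move=> p2.
have [l dl] := dual_vector d_neq0.
have [|s1 Ss1 _] := S_blk (f := l); first by rewrite dl oner_neq0.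
have F01 c := char2_cases c p2.
have F2 (v : 'rV[F]_N) : v + v = 0.
  by rewrite -mulr2n -scaler_nat -p2 (pcharf0 (pchar_Fp p_pr)) scale0r.
(* Elements are repeated when S has fewer than three. *)
have [s2 [s3 [Ss2 Ss3 sS]]] : exists s2 s3, [/\ s2 \in S, s3 \in S & S \subset [set s1; s2; s3]].
  have [S1E|[s2 S1s2]] := set_0Vmem (S :\ s1).
    by exists s1, s1; split=> //; rewrite !setUid -setD_eq0 S1E.
  have [S2E|[s3 S2s3]] := set_0Vmem (S :\ s1 :\ s2).
    exists s2, s2; move: S1s2; rewrite 2!inE => /andP[_ Ss2]; split=> //.
    by rewrite -setUA setUid -setD_eq0 -setDDl S2E.
  exists s2, s3; move: (S1s2) (S2s3); rewrite !inE => /andP[_ Ss2] /and3P[_ _ Ss3]; split=> //.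
  rewrite -setD_eq0 -!setDDl -cards_eq0.
  have := cardsD1 s1 S; have := cardsD1 s2 (S :\ s1); have := cardsD1 s3 (S :\ s1 :\ s2).
  rewrite Ss1 S1s2 S2s3; rewrite !add1n => -> -> ES; move: le_S p2; rewrite ES; lia.
have [|ndU] := boolP (d <= (s2 - s1) + (s3 - s1))%MS.
  case/sub_addsmxP=> -[x y] /=; rewrite [x]mx11_scalar [y]mx11_scalar !mul_scalar_mx.
  case: (F01 (x 0 0)) => ->; case: (F01 (y 0 0)) => ->; rewrite ?scale0r ?scale1r ?add0r ?addr0 => dE.
  - by move: d_neq0; rewrite dE eqxx.
  - by exists s1 => //; rewrite dE addrC subrK.
  - by exists s1 => //; rewrite dE addrC subrK.
  - exists s2 => //; rewrite dE addrACA -opprD F2 subr0 addrA F2 add0r //.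
have [y Uy dy] : exists2 y : 'cV_N, ((s2 - s1) + (s3 - s1))%MS *m y = 0 & d *m y != 0.
  have [/existsP[y /andP[/eqP Uy dy]]|ny] := boolP [exists y : 'cV_N,
      (((s2 - s1) + (s3 - s1))%MS *m y == 0) && (d *m y != 0)]; first by exists y.
  case/negP: ndU; apply: sub_row_functional => y Uy; apply/eqP/negPn/negP => dy.
  by case/existsP: ny; exists y; rewrite Uy eqxx.
have sy s : s \in S -> s *m y = s1 *m y.
  move=> Ss; have : (s - s1 <= (s2 - s1) + (s3 - s1))%MS.
    have := subsetP sS _ Ss; rewrite !inE -orbA => /or3P[] /eqP->.
    - by rewrite subrr sub0mx.
    - exact: addsmxSl.
    - exact: addsmxSr.
  case/submxP=> D Es; apply/eqP; rewrite -subr_eq0 -mulmxBl Es -mulmxA Uy mulmx0 //.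
(* The multiple of [psi] moves the common value on S to 1 without changing the value at d. *)
have [|s Ss] := S_blk (f := y + psi *m (1 - s1 *m y)).
  by rewrite mulmxDr mulmxA d_psi mul0mx addr0.
rewrite mulmxDr mulmxA S1 // mul1mx sy // addrC subrK => /eqP.
by rewrite oner_eq0.
Qed.

Let Y := [set y : 'cV[F]_N | d *m y == 0].
Let level (y : 'cV[F]_N) c := [set s in S | (s *m y) 0 0 == c].

(** Choose l with l(d) = 1. The functionals y and l project S to a plane in which d is vertical.
    Since z y + l - x psi takes the value 1 at d, it vanishes somewhere on S, which is the covering
    condition for the points (y(s), l(s)). *)
Lemma exists_heavy_level y : (2 < p)%N -> y \in Y -> exists c, (p <= #|level y c|)%N.
Proof.
move=> p_gt2; rewrite inE => /eqP dy; have [l dl] := dual_vector d_neq0.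
apply: (@planar_blocking _ p_pr _ _ _ (fun s => (s *m l) 0 0)) => // x z.
have [|s Ss] := S_blk (f := z *: y + l - x *: psi).
  by rewrite mulmxBr mulmxDr -!scalemxAr dy dl d_psi !scaler0 add0r subr0 oner_neq0.
rewrite mulmxBr mulmxDr -!scalemxAr S1 // => /matrixP/(_ 0 0); rewrite !mxE eqxx mulr1 => E.
by exists s => //; apply/eqP; rewrite eq_sym -subr_eq0 mulrC !mxE E.
Qed.

Lemma odd_contains_line : (2 < p)%N -> exists2 s, s \in S & forall c, s + c *: d \in S.
Proof.
move=> p_gt2.
have [c cP] : exists c : 'cV[F]_N -> F, forall y, y \in Y -> (p <= #|level y (c y)|)%N.
  (* The default 0 is never reached on [Y], where a heavy level exists. *)
  exists (fun y => odflt 0 [pick c | (p <= #|level y c|)%N]) => y Yy.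
  case: pickP => [//|no] /=; have [c] := exists_heavy_level p_gt2 Yy.
  by rewrite no.
have lvS y b : level y b \subset S by apply/subsetP=> s; rewrite inE => /andP[].
have odd_p : odd p by case: (even_prime p_pr) => // p2; lia.
have YD y z : y \in Y -> z \in Y -> y + z \in Y.
  by rewrite !inE mulmxDr => /eqP-> /eqP->; rewrite addr0.
have cD : {in Y &, {morph c : y z / y + z}}.
  (* 3p > 2|S|, so the three heavy levels have a common point of S. *)
  move=> y z Yy Yz; pose A := level y (c y); pose B := level z (c z); pose C := level (y + z) (c (y + z)).
  have lAB := leq_cards_setI (lvS _ _ : A \subset S) (lvS _ _ : B \subset S).
  have lABC := leq_cards_setI (subset_trans (subsetIl _ _) (lvS _ _) : A :&: B \subset S) (lvS _ _ : C \subset S).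
  have : (0 < #|A :&: B :&: C|)%N.
    have := cP _ Yy; have := cP _ Yz; have := cP _ (YD _ _ Yy Yz).
    rewrite -/A -/B -/C; move: le_S; lia.
  case/card_gt0P=> s; rewrite !inE => /andP[/andP[/andP[_ /eqP<-] /andP[_ /eqP<-]] /andP[_ /eqP<-]].
  by rewrite mulmxDr mxE.
(* [K s] collects the functionals whose chosen heavy level contains s; [M] consists of the points
   lying on all these levels. Outside [M], [K s] is the kernel of a nonzero additive map. *)
pose K (s : 'rV[F]_N) := [set y in Y | (s *m y) 0%R 0%R - c y == 0%R].
pose M := [set s in S | K s == Y].
have leK s : s \in S :\: M -> (#|K s| * p <= #|Y|)%N.
  rewrite !inE negb_and => /andP[/orP[/negP//|neK] Ss].
  have gY : group_set Y.
    by apply/group_setP; split=> [|y z]; [rewrite inE mulmx0 | exact: YD].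
  rewrite (@card_additive_kernel p _ (Group gY)) // => [y z Yy Yz|].
    by rewrite cD // mulmxDr mxE opprD addrACA.
  have /properP[_ [y Yy nKy]] : K s \proper Y.
    by rewrite properEneq neK; apply/subsetP => y; rewrite inE => /andP[].
  by exists y => //; move: nKy; rewrite inE Yy.
have sumE : (\sum_(y in Y) #|level y (c y)| = \sum_(s in S) #|K s|)%N.
  under eq_bigr do rewrite card_setId_sum.
  under [RHS]eq_bigr do rewrite card_setId_sum.
  rewrite exchange_big /=; apply: eq_bigr => s _; apply: eq_bigr => y _.
  by rewrite subr_eq0.
have Y_gt0 : (0 < #|Y|)%N by apply/card_gt0P; exists 0; rewrite inE mulmx0.
have sMS : M \subset S by apply/subsetP=> s; rewrite inE => /andP[].
(* Counting incidences gives p^2 <= p|M| + |S| - |M|. If |M| <= p - 1, the right side is at most (p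
   - 1)^2 + 3p/2, which is below p^2 for p > 2. *)
have le_pM : (p <= #|M|)%N.
  have lo : (#|Y| * p <= \sum_(y in Y) #|level y (c y)|)%N.
    by rewrite -sum_nat_const leq_sum.
  have hi : ((\sum_(s in S) #|K s|) * p <= #|M| * (#|Y| * p) + #|S :\: M| * #|Y|)%N.
    rewrite big_distrl /= (big_setID M) /= (setIidPr sMS) -!sum_nat_const.
    rewrite leq_add ?leq_sum // => s; rewrite inE => /andP[_ /eqP KY].
    by rewrite KY sum_nat_const.
  have : (#|Y| * (p * p) <= #|Y| * (#|M| * p + #|S :\: M|))%N.
    rewrite mulnDr mulnA [(_ * #|S :\: M|)%N]mulnC.
    rewrite [(#|Y| * (_ * p))%N]mulnCA; apply: leq_trans hi.
    by rewrite -sumE leq_mul2r lo orbT.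
  rewrite leq_pmul2l // cardsD (setIidPr sMS) leqNgt => le_pp; rewrite leqNgt; apply: contra le_pp => lt_Mp.
  have le_MS := subset_leq_card sMS.
  have : (#|M| * p <= p.-1 * p)%N by rewrite leq_mul2r; apply/orP; right; lia.
  move: le_S; nia.
have /card_gt0P[s1 Ms1] : (0 < #|M|)%N by apply: leq_trans le_pM; apply: prime_gt0.
have MY s y : s \in M -> y \in Y -> (s *m y) 0 0 = c y.
  rewrite inE => /andP[_ /eqP<-]; rewrite inE => /andP[_ /eqP/subr0_eq] //.
(* Every functional killing d is constant on [M], so [M] lies in one translate of the line of d;
   having at least p elements, it fills it. *)
have ME : M = [set s1 + a *: d | a : F].
  apply/eqP; rewrite eqEcard (leq_trans (leq_imset_card _ _)) ?card_Fp // andbT.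
  apply/subsetP=> s Ms; have /sub_rVP[a Ea] : (s - s1 <= d)%MS.
    apply: sub_row_functional => y /eqP dy.
    have Yy : y \in Y by rewrite inE.
    rewrite mulmxBl [s *m y]mx11_scalar [s1 *m y]mx11_scalar.
    by rewrite (MY _ _ Ms Yy) (MY _ _ Ms1 Yy) subrr.
  by apply/imsetP; exists a => //; rewrite -Ea addrC subrK.
exists s1 => [|a]; first exact: subsetP sMS _ Ms1.
by apply: subsetP sMS _ _; rewrite ME; apply: (imset_f (fun a => s1 + a *: d)).
Qed.

Lemma blocking_contains_line : exists2 s, s \in S & forall c, s + c *: d \in S.
Proof.
have [p_gt2|] := ltnP 2 p; first exact: odd_contains_line.
move=> p_le2; have p2 : p = 2%N by apply/eqP; rewrite eqn_leq p_le2 prime_gt1.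
have [s Ss Ssd] := char2_contains_line p2; exists s => // c.
have [->|->] := char2_cases c p2; first by rewrite scale0r addr0.
by rewrite scale1r.
Qed.

End Functionals.
End AffineBlocking.

(** * F_p-subspaces as additive subgroups, and F_p-valued functionals on them *)

Section Subspaces.
Variables (p t n : nat) (L : finFieldType).
Hypotheses (p_pr : prime p) (cardL : #|L| = (p ^ t)%N).
Local Notation V := 'rV[L]_n.
Local Notation span := (@Defs.span L n).
Implicit Types (S P X : {set V}) (x y : V).

Lemma mulrn_char x : x *+ p = 0.
Proof.
have pL : (p%:R : L) = 0.
  have : (p%:R : L) ^+ t = 0.
    rewrite -natrX -cardL.
    by have := expg_cardG (in_setT (1 : L)); rewrite cardsT FinRing.zmodXgE.
  by move/eqP; rewrite expf_eq0 => /andP[_ /eqP].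
by rewrite -scaler_nat pL scale0r.
Qed.

Lemma mulrn_mod x i : x *+ (i %% p) = x *+ i.
Proof. by rewrite {2}(divn_eq i p) mulrnDr mulnC mulrnA mulrn_char mul0rn add0r. Qed.

Lemma mulrn_Fp_inv x (c : 'F_p) : c != 0 -> x *+ c *+ (c^-1 : 'F_p) = x.
Proof.
move=> c0; rewrite -mulrnA -mulrn_mod -(val_Fp_nat p_pr) natrM !natr_Zp divff //.
Qed.

Lemma is_subP S :
  reflect (0 \in S /\ {in S &, forall x y, x + y \in S}) (is_sub S).
Proof.
apply: (iffP andP) => -[S0 SD]; split=> //.
  by move=> x y Sx Sy; move/forall_inP/(_ _ Sx)/forall_inP/(_ _ Sy): SD.
by apply/forall_inP=> x Sx; apply/forall_inP=> y Sy; apply: SD.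
Qed.

Lemma is_sub_group_set S : is_sub S = group_set S.
Proof.
apply/is_subP/group_setP => -[S0 SD]; split=> // x y Sx Sy; exact: SD.
Qed.

Lemma Fspan_subset X S : is_sub S -> X \subset S -> span X \subset S.
Proof. by move=> sS sXS; apply/subsetP=> x /bigcapP; apply; rewrite sS.
Qed.

Lemma is_sub_span X : is_sub (span X).
Proof.
apply/is_subP; split=> [|x y /bigcapP Sx /bigcapP Sy]; apply/bigcapP=> S SP.
  by case/andP: SP => /is_subP[].
by have [/is_subP[_ SD] _] := andP SP; rewrite SD ?Sx ?Sy.
Qed.

Lemma subset_Fspan X : X \subset span X.
Proof. by apply/bigcapsP=> S /andP[]. Qed.

Lemma sub_mulrn S x i : is_sub S -> x \in S -> x *+ i \in S.
Proof. by case/is_subP=> S0 SD Sx; elim: i => // i IHi; rewrite mulrS SD. Qed.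

Lemma sub_opp S x : is_sub S -> x \in S -> - x \in S.
Proof.
by rewrite is_sub_group_set => gS Sx; have := groupVr (G := Group gS) Sx.
Qed.

Lemma sub_subr S x y : is_sub S -> x \in S -> y \in S -> x - y \in S.
Proof. by move=> sS Sx Sy; case/is_subP: (sS) => _ ->; rewrite ?sub_opp. Qed.

(** The point of PG(nt-1,p) spanned by a nonzero x: in characteristic p the F_p-multiples are the
    natural multiples, so the span is a cyclic group. *)
Definition Fline x : {set V} := <[x]>%g.

Lemma FlineP x y : reflect (exists i : nat, y = x *+ i) (y \in Fline x).
Proof. exact: (iffP (@cycleP _ x y)). Qed.

Lemma is_sub_Fline x : is_sub (Fline x).
Proof. by rewrite is_sub_group_set groupP. Qed.

Lemma card_Fline x : x != 0 -> #|Fline x| = p.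
Proof.
by move=> x0; rewrite -orderE (nt_prime_order p_pr) ?FinRing.zmodXgE ?mulrn_char.
Qed.

Lemma Fline_subset S x : is_sub S -> x \in S -> Fline x \subset S.
Proof. by move=> sS Sx; apply/subsetP=> _ /FlineP[i ->]; apply: sub_mulrn. Qed.

Lemma Fline_id x : x \in Fline x.
Proof. exact: cycle_id. Qed.

Lemma vdim1_Fline P x : vdim_is p P 1 -> x \in P -> x != 0 -> P = Fline x.
Proof.
case/andP=> sP /eqP cP Px x0; apply/esym/eqP.
by rewrite eqEcard Fline_subset //= card_Fline // cP expn1.
Qed.

Lemma card_gt1_neq0 S : (1 < #|S|)%N -> exists2 x, x \in S & x != 0.
Proof.
move=> S_gt1; have [/existsP[x /andP[]]|no] := boolP [exists x, (x \in S) && (x != 0)].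
  by exists x.
have sS0 : S \subset [set 0].
  apply/subsetP=> x Sx; rewrite inE; apply/negPn/negP=> x0.
  by case/existsP: no; exists x; rewrite Sx.
by have := subset_leq_card sS0; rewrite cards1 leqNgt S_gt1.
Qed.

(** The additive group is nontrivial and elementary abelian, so it is a row space over F_p. *)
Lemma exists_coordinates : (0 < t)%N -> (0 < n)%N ->
  exists M (theta : V -> 'rV['F_p]_M), {morph theta : x y / x + y} /\ injective theta.
Proof.
move=> t_gt0 n_gt0.
have abV : (p.-abelem [set: V])%g.
  rewrite abelemE // FinRing.zmod_abelian; apply/exponentP=> x _; rewrite FinRing.zmodXgE.
  exact: mulrn_char.
have ntV : [set: V] :!=: 1%g.
  rewrite trivg_card1 cardsT card_mx cardL mul1n -expnM.
  by rewrite -(expn0 p) eqn_exp2l ?prime_gt1 // -lt0n muln_gt0 t_gt0.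
exists _, (abelem_rV abV ntV); split.
- by move=> x y; rewrite -FinRing.zmodMgE abelem_rV_M ?inE.
- by move=> x y; apply: abelem_rV_inj; rewrite inE.
Qed.

Section Coordinates.
Variables (M : nat) (theta : V -> 'rV['F_p]_M).
Hypotheses (thetaD : {morph theta : x y / x + y}) (theta_inj : injective theta).

Definition ev (f : 'cV['F_p]_M) x : 'F_p := (theta x *m f) 0 0.

Lemma evD f : {morph ev f : x y / x + y}.
Proof. by move=> x y; rewrite /ev thetaD mulmxDl mxE. Qed.

Lemma ev0 f : ev f 0 = 0.
Proof. by apply: (addIr (ev f 0)); rewrite -evD !add0r. Qed.

Lemma evM f x i : ev f (x *+ i) = ev f x *+ i.
Proof. by elim: i => [|i IHi]; rewrite ?ev0 // !mulrS evD IHi. Qed.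

Lemma evB f : {morph ev f : x y / x - y}.
Proof. by move=> x y; apply: (addIr (ev f y)); rewrite -evD !subrK. Qed.

Lemma theta_mulrn x i : theta (x *+ i) = theta x *+ i.
Proof.
elim: i => [|i IHi]; last by rewrite !mulrS thetaD IHi.
by apply: (addIr (theta 0)); rewrite -thetaD !add0r.
Qed.

Lemma theta_sum (I : finType) (F : I -> V) : theta (\sum_i F i) = \sum_i theta (F i).
Proof. by apply: (big_morph theta thetaD); exact: (theta_mulrn 0 0). Qed.

(** If [theta w] were a combination of the rows [theta x] with x in S, lifting its coefficients to
    natural numbers would put w in S, by injectivity of [theta]. *)
Lemma separating_functional S w : is_sub S -> w \notin S ->
  exists f, {in S, forall x, ev f x = 0} /\ ev f w = 1.
Proof.
move=> sS nSw; pose A := \matrix_(i < #|S|) theta (enum_val i).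
have ndA : ~~ (theta w <= A)%MS.
  apply: contra nSw => /submxP[u Ew].
  suff -> : w = \sum_(i < #|S|) enum_val i *+ u 0 i.
    elim/big_ind: _ => [|x y Sx Sy|i _]; first by case/is_subP: sS.
      by case/is_subP: sS => _ ->.
    by rewrite sub_mulrn ?enum_valP.
  apply: theta_inj; rewrite Ew theta_sum mulmx_sum_row; apply: eq_bigr => i _.
  by rewrite theta_mulrn rowK -scaler_nat natr_Zp.
have [/existsP[y /andP[/eqP Ay wy]]|no] :=
  boolP [exists y : 'cV['F_p]_M, (A *m y == 0) && (theta w *m y != 0)]; last first.
  case/negP: ndA; apply: sub_row_functional => y Ay; apply/eqP/negPn/negP=> wy.
  by case/existsP: no; exists y; rewrite Ay eqxx.
have ewy : ev y w != 0.
  by apply: contra wy => /eqP ewy; rewrite [_ *m _]mx11_scalar -/(ev y w) ewy raddf0.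
exists ((ev y w)^-1 *: y); split=> [x Sx|]; last first.
  by rewrite /ev -scalemxAr mxE mulVf.
rewrite /ev -scalemxAr mxE; have := congr1 (row (enum_rank_in Sx x)) Ay.
by rewrite row_mul rowK enum_rankK_in // row0 => ->; rewrite [X in _ * X]mxE mulr0.
Qed.

Lemma functional_blocking_line S f d :
  (2 * #|S| <= 3 * p)%N -> {in S, forall x, ev f x = 1} -> ev f d = 0 -> d != 0 ->
  (forall g, ev g d != 0 -> exists2 s, s \in S & ev g s = 0) ->
  exists2 s, s \in S & forall i, s + d *+ i \in S.
Proof.
move=> leS Sf df d0 blk.
have evE g x : theta x *m g = (ev g x)%:M by rewrite [LHS]mx11_scalar.
have [||||g|_ /imsetP[s Ss ->] sP] :=
  @blocking_contains_line p p_pr M (theta @: S) f (theta d).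
- by rewrite card_imset.
- by move=> _ /imsetP[s Ss ->]; rewrite evE Sf.
- by rewrite evE df raddf0.
- by apply: contra d0 => /eqP td; apply/eqP/theta_inj; rewrite td (theta_mulrn 0 0).
- move=> dg; have [|s Ss sg] := blk g.
    by apply: contra dg => /eqP E; rewrite evE E raddf0.
  by exists (theta s); rewrite ?imset_f // evE sg raddf0.
exists s => // i; have := sP i%:R; rewrite scaler_nat -theta_mulrn -thetaD.
by rewrite mem_imset.
Qed.

Lemma card_ev_kernel S f x : is_sub S -> x \in S -> ev f x != 0 ->
  (#|[set y in S | ev f y == 0%R]| * p = #|S|)%N.
Proof.
rewrite is_sub_group_set => gS Sx fx.
apply: (@card_additive_kernel p _ (Group gS)) => //; last by exists x.
by move=> y z _ _; apply: evD.
Qed.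

Lemma is_sub_ev_kernel S f : is_sub S -> is_sub [set y in S | ev f y == 0%R].
Proof.
case/is_subP=> S0 SD; apply/is_subP; rewrite inE S0 ev0 eqxx; split=> // x y.
by rewrite !inE evD => /andP[Sx /eqP->] /andP[Sy /eqP->]; rewrite addr0 SD ?eqxx.
Qed.

End Coordinates.
End Subspaces.

(** * Spread elements, cones and the size of B(K) *)

Section Spread.
Variables (p t n : nat) (L : finFieldType).
Hypotheses (p_pr : prime p) (cardL : #|L| = (p ^ t)%N).
Local Notation V := 'rV[L]_n.
Local Notation span := (@Defs.span L n).
Implicit Types (S P X U W Sigma Omega : {set V}) (x y u v : V).

Lemma Lline_id x : x \in Lline x.
Proof. by apply/imsetP; exists 1; rewrite ?scale1r. Qed.

Lemma Lline_scale c x : c != 0 -> Lline (c *: x) = Lline x.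
Proof.
move=> c0; apply/setP=> y; apply/imsetP/imsetP => -[a _ ->]; last first.
  by exists (a / c); rewrite // scalerA divfK.
by exists (a * c); rewrite // scalerA.
Qed.

Lemma Lline_spread x : x != 0 -> Lline x \in spread L n.
Proof. by move=> x0; rewrite inE; apply/existsP; exists x; rewrite x0 eqxx. Qed.

Lemma spread_Lline X x : X \in spread L n -> x \in X -> x != 0 -> X = Lline x.
Proof.
rewrite inE => /existsP[v /andP[_ /eqP->]] /imsetP[c _ ->].
by rewrite scaler_eq0 negb_or => /andP[c0 _]; rewrite Lline_scale.
Qed.

Lemma Lline_subset S x :
  (forall c y, y \in S -> c *: y \in S) -> (Lline x \subset S) = (x \in S).
Proof.
move=> SZ; apply/idP/idP => [/subsetP/(_ _ (Lline_id x))//|Sx].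
by apply/subsetP=> _ /imsetP[c _ ->]; apply: SZ.
Qed.

Lemma Lline_Bof U x : x \in U -> x != 0 -> Lline x \in Bof U.
Proof.
move=> Ux x0; rewrite inE Lline_spread //=; apply/negP => /subsetP/(_ x).
by rewrite !inE Lline_id Ux => /(_ isT); apply/negP.
Qed.

Lemma BofP U X : X \in Bof U -> exists x, [/\ x \in U, x != 0 & X = Lline x].
Proof.
rewrite inE => /andP[DX /subsetPn[x]]; rewrite !inE => /andP[Xx Ux] x0.
by exists x; split=> //; apply: spread_Lline.
Qed.

Lemma BofS U W : U \subset W -> Bof U \subset Bof W.
Proof.
move=> sUW; apply/subsetP=> _ /BofP[x [Ux x0 ->]].
by rewrite Lline_Bof ?(subsetP sUW).
Qed.

(** The vectors that c sends into S form an F_p-subspace containing every spread element inside S,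
    hence containing their span S. *)
Lemma Dsubspace_scale S r c x : Dsubspace p t S r -> x \in S -> c *: x \in S.
Proof.
case/andP=> /andP[/is_subP[S0 SD] _] /eqP ES Sx.
suff /subsetP/(_ _ Sx) : S \subset [set y | c *: y \in S] by rewrite inE.
rewrite {1}ES; apply: Fspan_subset.
  apply/is_subP; split=> [|y z]; rewrite !inE ?scaler0 // => Sy Sz.
  by rewrite scalerDr SD.
apply/bigcupsP=> X /andP[]; rewrite inE => /existsP[v /andP[_ /eqP->]] /subsetP sXS.
apply/subsetP=> _ /imsetP[a _ ->]; rewrite inE scalerA; apply: sXS.
by apply/imsetP; exists (c * a).
Qed.

(* A spread element not in the L-subspace Sigma meets each coset of Sigma at most once. *)
Lemma Lline_affine_inj Sigma u v : is_sub Sigma ->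
  (forall c x, x \in Sigma -> c *: x \in Sigma) -> v \notin Sigma -> u - v \in Sigma ->
  Lline u = Lline v -> u = v.
Proof.
move=> sS SZ nSv Suv E; have := Lline_id u; rewrite E => /imsetP[c _ Eu].
have [c1|c1] := eqVneq c 1; first by rewrite Eu c1 scale1r.
case/negP: nSv; have: (c - 1)^-1 *: (u - v) \in Sigma by apply: SZ.
by rewrite Eu -{2}[v]scale1r -scalerBl scalerA mulVf ?scale1r // subr_eq0.
Qed.

Lemma cone_incl Omega (Bbar : {set {set V}}) P x y :
  P \in Bbar -> x \in P -> y \in Omega -> x + y \in cone Omega Bbar.
Proof.
move=> BP Px Oy; apply/bigcupP; exists P => //.
have [_ sD] := is_subP _ (is_sub_span (P :|: Omega)).
by apply: sD; apply: (subsetP (subset_Fspan _)); rewrite inE ?Px ?Oy ?orbT.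
Qed.

Lemma card_mulg_Fp (S1 S2 : {set V}) : is_sub S1 -> is_sub S2 ->
  S1 :&: S2 \subset [set 0] -> #|(S1 * S2)%g| = (#|S1| * #|S2|)%N.
Proof.
rewrite !is_sub_group_set => g1 g2 sI.
by apply: (@TI_cardMg _ (Group g1) (Group g2)); apply/trivgP.
Qed.

Lemma is_sub_mulg (S1 S2 : {set V}) : is_sub S1 -> is_sub S2 -> is_sub (S1 * S2)%g.
Proof.
move=> /is_subP[z1 D1] /is_subP[z2 D2]; apply/is_subP; split.
  by rewrite -[0]addr0 -FinRing.zmodMgE mem_mulg.
move=> _ _ /mulsgP[a b Sa Sb ->] /mulsgP[c d Sc Sd ->].
by rewrite !FinRing.zmodMgE addrACA -FinRing.zmodMgE mem_mulg ?D1 ?D2.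
Qed.

(** The dimensions t + 1 and (n - 1)t add up to nt + 1, so [mu] shares a nonzero vector with every
    L-hyperplane, which then contains the L-line of that vector. *)
Lemma Bof_blocking (mu : {set V}) : (0 < n)%N -> is_sub mu -> #|mu| = (p ^ t.+1)%N -> blocking (Bof mu).
Proof.
move=> n_gt0 smu cmu; split=> [|H /and3P[sH HZ /eqP cH]].
  by apply/subsetP=> X; rewrite inE => /andP[].
have [x] : exists2 x, x \in mu :&: H & x != 0.
  apply: card_gt1_neq0.
  have := smu; have := sH; rewrite !is_sub_group_set => gH gmu.
  have := mul_cardG (Group gmu) (Group gH); rewrite /= cmu cH cardL -expnM -expnD.
  have : (#|(mu * H)%g| <= p ^ (t * n))%N.
    by have := max_card (mem (mu * H)%g); rewrite card_mx mul1n cardL -expnM.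
  have -> : (t.+1 + t * n.-1 = (t * n).+1)%N by case: (n) n_gt0 => // m _ /=; rewrite mulnS addSn.
  move=> le E; rewrite ltnNge; apply/negP=> le1.
  have : (p ^ (t * n).+1 <= p ^ (t * n) * 1)%N by rewrite E leq_mul.
  by rewrite muln1 leq_exp2l ?prime_gt1 // ltnn.
rewrite inE => /andP[mux Hx] x0; exists (Lline x); first exact: Lline_Bof.
rewrite Lline_subset // => c y Hy.
by move/forallP/(_ c)/forall_inP: HZ; apply.
Qed.

(** The L-lines of the sums x + a, with x in S and a in [Omega], are distinct and not contained in
    [Sigma]; the L-line of d lies in [Sigma] and makes the inequality strict. *)
Lemma card_Bof_cone_ge Sigma Omega S d (Bbar : {set {set V}}) :
  is_sub Sigma -> (forall c x, x \in Sigma -> c *: x \in Sigma) ->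
  is_sub Omega -> Omega \subset Sigma ->
  {in S, forall x, x \notin Sigma /\ Fline x \in Bbar} ->
  {in S &, forall x y, x - y \in Sigma} ->
  {in S &, forall x y, x - y \in Omega -> x = y} ->
  d != 0 -> d \in Sigma -> Fline d \in Bbar ->
  (#|S| * #|Omega| < #|Bof (cone Omega Bbar)|)%N.
Proof.
move=> sS SZ sO sOS SB SS SO d0 Sd Bd.
pose A := [set Lline (u.1 + u.2) | u in setX S Omega].
have O0 : 0 \in Omega by case/is_subP: sO.
have SD : {in Sigma &, forall x y, x + y \in Sigma} by case/is_subP: sS.
have nSA x y : x \in S -> y \in Omega -> x + y \notin Sigma.
  move=> Sx Oy; have [nSx _] := SB _ Sx; apply: contra nSx => Sxy.
  by rewrite -[x](addrK y); apply: sub_subr => //; apply: subsetP sOS _ Oy.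
have cA : #|A| = (#|S| * #|Omega|)%N.
  rewrite card_in_imset ?cardsX // => -[x a] [y b] /setXP[/= Sx Oa] /setXP[/= Sy Ob] E.
  have Exy : x + a = y + b.
    apply: (Lline_affine_inj sS SZ (nSA _ _ Sy Ob) _ E).
    by rewrite opprD addrACA; apply: SD; [exact: SS | apply: (subsetP sOS); apply: sub_subr].
  have Ex : x = y.
    apply: SO => //; have -> : x - y = b - a by apply/eqP; rewrite subr_eq addrAC [b + y]addrC -Exy addrK.
    by rewrite sub_subr.
  by move: Exy; rewrite Ex => /addrI->.
rewrite -cA; apply: proper_card; apply/properP; split.
  apply/subsetP=> _ /imsetP[[x a] /setXP[/= Sx Oa] ->]; apply: Lline_Bof.
    by have [_ Bx] := SB _ Sx; apply: cone_incl Bx _ Oa; apply: Fline_id.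
  apply: contraNneq (nSA _ _ Sx Oa) => ->; by case/is_subP: sS.
exists (Lline d).
  by apply: Lline_Bof => //; rewrite -[d]addr0; apply: cone_incl Bd (Fline_id _) O0.
apply/imsetP=> -[[x a] /setXP[/= Sx Oa] E].
by have := nSA _ _ Sx Oa; rewrite -(Lline_subset _ SZ) -E Lline_subset // Sd.
Qed.

End Spread.

(** * Linearity and the Rédei property of the cone *)

Lemma mulrn_Fp_eq0 (p t n : nat) (L : finFieldType) (x : 'rV[L]_n) i :
  prime p -> #|L| = (p ^ t)%N -> (i%:R : 'F_p) = 0 -> x *+ i = 0.
Proof.
by move=> p_pr cardL i0; rewrite -(mulrn_mod cardL) -(val_Fp_nat p_pr) i0.
Qed.

Lemma exists_mulrn_inv (p t n : nat) (L : finFieldType) i :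
  prime p -> #|L| = (p ^ t)%N -> (i%:R : 'F_p) != 0 ->
  exists k, forall x : 'rV[L]_n, x *+ i *+ k = x.
Proof.
move=> p_pr cardL i0; exists ((i%:R : 'F_p)^-1 : 'F_p) => x.
by rewrite -{2}(mulrn_Fp_inv p_pr cardL x i0) val_Fp_nat // (mulrn_mod cardL).
Qed.

Theorem theorem5p5 (p n t : nat) (L : finFieldType)
    (Sigma Sigma' Y Omega Gamma' : {set 'rV[L]_n})
    (Bbar : {set {set 'rV[L]_n}}) :
  prime p -> (2 <= n)%N -> (1 <= t)%N -> #|L| = (p ^ t)%N ->
  (* Sigma : D_{n-2}-subspace, projective dim nt-t-1 *)
  Dsubspace p t Sigma n.-1 ->
  (* Sigma' : projective dim nt-t, containing Sigma *)
  vdim_is p Sigma' (n * t - t + 1) -> Sigma \subset Sigma' ->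
  (* Y in D, Y in Sigma; Omega a hyperplane of Y *)
  Y \in spread L n -> Y \subset Sigma ->
  vdim_is p Omega (t - 1) -> Omega \subset Y ->
  (* Gamma' : projective dim nt-2t+1 in Sigma', disjoint from Omega *)
  vdim_is p Gamma' (n * t - 2 * t + 2) -> Gamma' \subset Sigma' ->
  Gamma' :&: Omega = [set 0] ->
  (* Bbar blocking w.r.t. hyperplanes of Gamma' *)
  blocking_in p Gamma' (n * t - 2 * t + 2) Bbar ->
  (* Bbar meets Gamma = Gamma' ∩ Sigma in a single point *)
  #|[set P in Bbar | P \subset Gamma' :&: Sigma]| = 1%N ->
  (* lines of Gamma' through T = Gamma ∩ Y are not contained in Bbar ∪ {T} *)
  (forall l : {set 'rV[L]_n}, vdim_is p l 2 -> l \subset Gamma' ->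
     Gamma' :&: Sigma :&: Y \subset l ->
     exists P : {set 'rV[L]_n}, [/\ vdim_is p P 1, P \subset l,
        P != Gamma' :&: Sigma :&: Y & P \notin Bbar]) ->
  small p t (Bof (cone Omega Bbar)) ->
  minimal_blocking (Bof (cone Omega Bbar)) ->
  Fp_linear (Bof (cone Omega Bbar)) /\ Redei_type p t (Bof (cone Omega Bbar)).
Proof.
move=> p_pr n_ge2 t_gt0 cardL DS /andP[sS' /eqP cS'] sSS' _ sYS /andP[sO /eqP cO] sOY.
move=> /andP[sG /eqP cG] sGS' GO0 [Bpts Bblk] cB1 _ smallB [_ minB].
have /andP[/andP[sS /eqP cS] _] := DS.
have SZ c x : x \in Sigma -> c *: x \in Sigma by apply: Dsubspace_scale DS.
have n_gt0 : (0 < n)%N by apply: ltnW.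
have p_gt1 := prime_gt1 p_pr; have p_gt0 := prime_gt0 p_pr.
have le2tnt : (2 * t <= n * t)%N by rewrite leq_mul2r n_ge2 orbT.
have ntE : (n.-1 * t + t = n * t)%N by rewrite -mulSnr prednK.
have expS' : (n * t - t + 1 = (n.-1 * t).+1)%N by rewrite -ntE addnK addn1.
have expG : (n * t - 2 * t + 2 + (t - 1) = (n.-1 * t).+1)%N.
  by move: ntE le2tnt t_gt0; clear; move: (n * t)%N (n.-1 * t)%N => a b; lia.
have sOS := subset_trans sOY sYS.
have [w Gw nSw] : exists2 w, w \in Gamma' & w \notin Sigma.
  (* Otherwise [Sigma] would contain the direct sum of [Gamma'] and [Omega], whose dimension is one
     larger. *)
  apply/subsetPn; apply/negP=> sGS.
  have sGOS : (Gamma' * Omega)%g \subset Sigma.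
    apply/subsetP=> _ /mulsgP[a b Ga Ob ->]; have [_ ->] := is_subP _ sS => //.
      exact: subsetP sGS _ Ga.
    exact: subsetP sOS _ Ob.
  have := subset_leq_card sGOS; rewrite card_mulg_Fp ?GO0 // cG cO cS -expnD.
  by rewrite leq_exp2l // expG ltnn.
have [P0 P0E] := cards1P (introT eqP cB1).
have : P0 \in [set P0] by rewrite inE.
rewrite -P0E inE subsetI => /and3P[BP0 sP0G sP0S].
have [vP0 _] := Bpts _ BP0.
have [d P0d d0] : exists2 d, d \in P0 & d != 0.
  by apply: card_gt1_neq0; case/andP: vP0 => _ /eqP->.
have EP0 := vdim1_Fline p_pr cardL vP0 P0d d0.
have Gd := subsetP sP0G _ P0d; have Sd := subsetP sP0S _ P0d.
have [M [theta [tD ti]]] := exists_coordinates (n := n) p_pr cardL t_gt0 n_gt0.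
have [f [fS fw]] := separating_functional tD ti sS nSw.
(* [Sigma] has index p in [Sigma'], as has the kernel of f there, since f(w) = 1. *)
have kerf x : x \in Sigma' -> ev theta f x = 0 -> x \in Sigma.
  move=> S'x fx; suff -> : Sigma = [set y in Sigma' | ev theta f y == 0%R].
    by rewrite inE S'x fx eqxx.
  apply/eqP; rewrite eqEcard; apply/andP; split.
    by apply/subsetP=> y Sy; rewrite inE (subsetP sSS') // fS ?eqxx.
  rewrite -(leq_pmul2r p_gt0) (card_ev_kernel p_pr tD sS' (subsetP sGS' _ Gw)).
    by rewrite cS' cS -expnSr expS'.
  by rewrite fw oner_neq0.
have f1 x : ev theta f x = 1 -> x \notin Sigma.
  by move=> fx; apply/negP=> /fS; rewrite fx => /eqP; rewrite oner_eq0.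
(* The condition f = 1 selects one representative vector for each point of [Bbar] outside
   [Sigma]. *)
pose S := [set x in Gamma' | (ev theta f x == 1%R) && (Fline x \in Bbar)].
have SP x : x \in S -> [/\ x \in Gamma', ev theta f x = 1 & Fline x \in Bbar].
  by rewrite inE => /and3P[? /eqP].
(* From |S| p^(t-1) + 1 <= |B| and 2|B| <= 3p^t + 2 one gets 2|S| p^(t-1) <= 3p^t. *)
have leS : (2 * #|S| <= 3 * p)%N.
  have := @card_Bof_cone_ge _ L Sigma Omega S d Bbar sS SZ sO sOS.
  have ptE : (p ^ t = p * p ^ (t - 1))%N by rewrite -expnS subn1 prednK.
  have pt_gt0 : (0 < p ^ (t - 1))%N by rewrite expn_gt0 p_gt0.
  rewrite -EP0 cO => /(_ _ _ _ d0 Sd BP0) ltB.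
  rewrite -(leq_pmul2r pt_gt0) -!mulnA -ptE.
  suff : (#|S| * p ^ (t - 1) < #|Bof (cone Omega Bbar)|)%N.
    by move: smallB; rewrite /small; clear; move: (_ * _)%N (p ^ t)%N #|_| => a b c; lia.
  apply: ltB => [x /SP[_ /f1 nSx Bx]|x y /SP[Gx fx _] /SP[Gy fy _]|x y /SP[Gx fx _] /SP[Gy fy _] Oxy] //.
    apply: kerf; last by rewrite evB // fx fy subrr.
    by apply: sub_subr => //; apply: subsetP sGS' _ _.
  have : x - y \in Gamma' :&: Omega by rewrite inE Oxy sub_subr.
  by rewrite GO0 inE subr_eq0 => /eqP.
have [||||g gd|s0 Ss0 s0d] := functional_blocking_line p_pr tD ti (S := S) (f := f) (d := d) => //.
- by move=> x /SP[].
- exact: fS.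
(* The kernel of g is a hyperplane of [Gamma'], so it contains a point of [Bbar]. That point is not
   [P0], because g(d) is nonzero, so it lies outside [Sigma] and can be scaled into S. *)
- pose H := [set y in Gamma' | ev theta g y == 0%R].
  have cH : (#|H| * p = #|Gamma'|)%N by apply: card_ev_kernel gd.
  have [||P BP sPH] := Bblk H.
  + rewrite /vdim_is is_sub_ev_kernel // -(eqn_pmul2r p_gt0) cH cG -expnSr.
    by rewrite addn2 eqxx.
  + by apply/subsetP=> x; rewrite inE => /andP[].
  have [vP sPG] := Bpts _ BP.
  have /subsetPn[x Px nSx] : ~~ (P \subset Sigma).
    apply/negP=> sPS; have : P \in [set P0] by rewrite -P0E inE BP subsetI sPG.
    rewrite inE => /eqP PP0; have := subsetP sPH d.
    by rewrite PP0 P0d inE (negPf gd) andbF => /(_ isT).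
  have Gx := subsetP sPG _ Px.
  have fx : ev theta f x != 0.
    by apply: contra nSx => /eqP; apply: kerf; apply: subsetP sGS' _ Gx.
  pose c := (ev theta f x)^-1.
  have fxc : ev theta f (x *+ c) = 1 by rewrite evM // -mulr_natr natr_Zp mulfV.
  have xc0 : x *+ c != 0 by apply: contra_eq_neq fxc => ->; rewrite ev0 // eq_sym oner_neq0.
  have sP : is_sub P by case/andP: vP.
  have Pxc : x *+ c \in P by apply: sub_mulrn.
  exists (x *+ c).
    by rewrite inE fxc eqxx (subsetP sPG) // -(vdim1_Fline p_pr cardL vP Pxc xc0).
  by have := subsetP sPH _ Pxc; rewrite inE => /andP[_ /eqP].
have [Gs0 fs0 Bs0] := SP _ Ss0.
pose mu0 := (Fline d * Omega)%g; pose mu := (Fline s0 * mu0)%g.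
have smu0 : is_sub mu0 by rewrite is_sub_mulg ?is_sub_Fline.
have smu : is_sub mu by rewrite is_sub_mulg ?is_sub_Fline.
have mu0S : mu0 \subset Sigma.
  apply/subsetP=> _ /mulsgP[_ b /FlineP[i ->] Ob ->]; have [_ ->] := is_subP _ sS => //.
    exact: sub_mulrn.
  exact: subsetP sOS _ Ob.
have cmu0 : #|mu0| = (p ^ t)%N.
  rewrite card_mulg_Fp ?is_sub_Fline //; last by rewrite -GO0 setSI // Fline_subset.
  by rewrite (card_Fline p_pr cardL) // cO -expnS subn1 prednK.
have nSs0 := f1 _ fs0.
have s0_neq0 : s0 != 0 by apply: contraNneq nSs0 => ->; case/is_subP: sS.
have s0_mod i : s0 *+ i \in Sigma -> (i%:R : 'F_p) = 0.
  by move/fS; rewrite evM // fs0.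
have cmu : #|mu| = (p ^ t.+1)%N.
  rewrite card_mulg_Fp ?is_sub_Fline //.
    by rewrite (card_Fline p_pr cardL) // cmu0 expnS.
  apply/subsetP=> x; rewrite 2!inE => /andP[/FlineP[i ->] /(subsetP mu0S)/s0_mod i0].
  by rewrite (mulrn_Fp_eq0 _ p_pr cardL i0).
have mu_cone : mu \subset cone Omega Bbar.
  apply/subsetP=> _ /mulsgP[_ _ /FlineP[i ->] /mulsgP[_ b /FlineP[j ->] Ob ->] ->].
  rewrite !FinRing.zmodMgE; have [i0|i0] := eqVneq (i%:R : 'F_p) 0.
    rewrite (mulrn_Fp_eq0 _ p_pr cardL i0) add0r; apply: cone_incl BP0 _ Ob.
    by rewrite sub_mulrn //; case/andP: vP0.
  (* With k inverse to i modulo p, i s0 + j d = i (s0 + jk d), a multiple of a vector of the line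
     found in S. *)
  have [k kE] := @exists_mulrn_inv p t n L i p_pr cardL i0.
  have [_ _ Bx] := SP _ (s0d (j * k)%N).
  rewrite addrA; apply: cone_incl Bx _ Ob; apply/FlineP; exists i.
  by rewrite mulrnDl mulrnA mulrnAC kE.
have muB : Bof mu = Bof (cone Omega Bbar).
  apply/eqP; have := BofS mu_cone; rewrite eqEproper => ->.
  by apply/negP=> /minB; apply; apply: (Bof_blocking p_pr cardL).
rewrite -muB; split; first by exists mu.
(* [Sigma] is the Rédei hyperplane: the elements of B(mu) outside it are the L-lines of s0 + m with
   m in [mu0], and these are p^t distinct ones. *)
exists Sigma; split.
  apply/and3P; split=> //; last by rewrite cS cardL -expnM mulnC.
  by apply/forallP=> c; apply/forall_inP=> x; apply: SZ.
rewrite setIdE -[RHS](cardsID [set X : {set 'rV[L]_n} | X \subset Sigma]); congr (_ + _)%N.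
have mu0D m : m \in mu0 -> s0 + m \notin Sigma.
  by move=> mu0m; apply: f1; rewrite evD // fs0 fS ?addr0 ?(subsetP mu0S).
rewrite -cmu0 -(card_in_imset (f := fun m => Lline (s0 + m)) (D := mu0)); last first.
  move=> m m' mu0m mu0m' E; apply: (addrI s0).
  apply: (Lline_affine_inj sS SZ (mu0D _ mu0m') _ E).
  by rewrite opprD addrACA subrr add0r sub_subr ?(subsetP mu0S).
congr #|pred_of_set _|; apply/setP=> X; rewrite in_setD in_set.
apply/imsetP/andP => [[m mu0m ->]|[nXS /BofP[x [mux x0 XE]]]].
  have := mu0D _ mu0m; rewrite Lline_subset // => nSm; split=> //; apply: Lline_Bof.
    by rewrite -FinRing.zmodMgE mem_mulg ?Fline_id.
  by apply: contraNneq nSm => ->; case/is_subP: sS.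
move: nXS; rewrite XE Lline_subset // => nSx.
case/mulsgP: mux (nSx) x0 => _ m /FlineP[i ->] mu0m -> nSxi x0.
rewrite FinRing.zmodMgE in nSxi x0 *.
have i0 : (i%:R : 'F_p) != 0.
  apply: contra nSxi => /eqP i0; rewrite (mulrn_Fp_eq0 _ p_pr cardL i0) add0r.
  exact: subsetP mu0S _ mu0m.
have [k kE] := @exists_mulrn_inv p t n L i p_pr cardL i0.
(* Dividing i s0 + m by i leaves its L-line unchanged and makes the coefficient of s0 equal to 1. *)
exists (m *+ k); first exact: sub_mulrn.
rewrite -{2}[s0]kE -mulrnDl -[(_ + _) *+ k]scaler_nat Lline_scale //.
apply: contra_neq x0 => k0; rewrite -[LHS]kE -scaler_nat k0.
by rewrite scale0r.
Qed.
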